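(* Let $H_1,H_2$ be real Hilbert spaces, let $C\subset H_1$ and $Q\subset H_2$ be nonempty closed convex subsets, and let $A:H_1\to H_2$ be a bounded linear operator. Let $f:C\times C\to\mathbb{R}$ and $g:Q\times Q\to\mathbb{R}$ be bifunctions that are upper semi-continuous in the first variable. Then the split equilibrium problem (SEP) determined by $(C,Q,A,f,g)$ is generalized well-posed if and only if $$S(\epsilon)\neq\emptyset\ \text{ for all }\epsilon>0\quad\text{and}\quad \alpha(S(\epsilon))\to 0\ \text{ as }\epsilon\to 0$$ (with $\epsilon>0$), where $\alpha$ is the Kuratowski measure of noncompactness.
   Context: The product $H_1\times H_2$ carries its usual Hilbert space norm. Split equilibrium problem (SEP): find $x^*\in C$ such that $f(x^*,p)\ge 0$ for all $p\in C$, and such that $y^*=Ax^*$ belongs to $Q$ and satisfies $g(y^*,q)\ge 0$ for all $q\in Q$. A solution is identified with the pair $(x^*,y^* )=(x^*,Ax^* )$, so the solution set is $$S=\{(x,y)\in C\times Q:\ y=Ax,\ f(x,p)\ge 0\ \forall p\in C,\ g(y,q)\ge 0\ \forall q\in Q\}.$$ For $\epsilon\ge 0$, the approximate solution set is $$S(\epsilon)=\{(x,y)\in C\times Q:\ \|y-Ax\|\le\epsilon,\ f(x,p)\ge-\epsilon\ \forall p\in C,\ g(y,q)\ge-\epsilon\ \forall q\in Q\}.$$ A sequence $\{(x_n,y_n)\}$ in $H_1\times H_2$ is an approximating sequence for the SEP if there exist real numbers $\epsilon_n>0$ with $\epsilon_n\to 0$ such that, for all $n$: $x_n\in C$, $y_n\in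 Q$, $\|y_n-Ax_n\|\le\epsilon_n$, $f(x_n,p)\ge-\epsilon_n$ for all $p\in C$, and $g(y_n,q)\ge-\epsilon_n$ for all $q\in Q$. The SEP is generalized well-posed if $S\ne\emptyset$ and every approximating sequence for the SEP has a subsequence which converges (in norm) to some element of $S$. For a nonempty subset $G$ of a Hilbert space, the Kuratowski measure of noncompactness is $$\alpha(G)=\inf\Big\{\epsilon>0:\ G\subset\bigcup_{i=1}^n G_i\ \text{for some } n\in\mathbb{N}\ \text{and sets } G_1,\dots,G_n \text{ with } \operatorname{diam}(G_i)<\epsilon,\ i=1,\dots,n\Big\},$$ with $\inf\emptyset=+\infty$, where $\operatorname{diam}(B)=\sup\{\|u-v\|:u,v\in B\}$. A function $h:K\to\mathbb{R}$ on a subset $K$ of a Hilbert space is upper semi-continuous if for every $x\in K$ and every sequence $\{x_n\}$ in $K$ with $x_n\to x$ in norm, $\limsup_{n\to\infty}h(x_n)\le h(x)$. The bifunctions being upper semi-continuous in the first variable means that $f(\cdot,p)$ is upper semi-continuous on $C$ for each $p\in C$ and $g(\cdot,q)$ is upper semi-continuous on $Q$ for each $q\in Q$. *)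

(* Defs.v *)
From HB Require Import structures.
From mathcomp Require Import all_boot all_order all_algebra.
From mathcomp Require Import ring lra.
From mathcomp Require Import all_classical all_reals all_analysis.

Set Implicit Arguments.
Unset Strict Implicit.
Unset Printing Implicit Defensive.

Import Order.TTheory GRing.Theory Num.Theory.
Import numFieldNormedType.Exports.

Local Open Scope classical_set_scope.
Local Open Scope ring_scope.

HB.mixin Record CompleteNormedModule_isHilbert (R : realType) H
    & CompleteNormedModule R H := {
  hdot : {dot H for idfun} ;
  hdot_norm : forall x : H, hdot x x = `|x| ^+ 2
}.

#[short(type="hilbertType")]
HB.structure Definition Hilbert (R : realType) :=
  {H of CompleteNormedModule R H & CompleteNormedModule_isHilbert R H}.

(* The library norms [H1 * H2] by the maximum of the two norms; [hprod H1 H2]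
   is an alias of that type which carries the Hilbert space norm instead. *)
Definition hprod (R : realType) (H1 H2 : hilbertType R) : Type :=
  (H1 * H2)%type.

Section hprod_normed.
Context {R : realType} {H1 H2 : hilbertType R}.
Local Notation H := (hprod H1 H2).

HB.instance Definition _ := GRing.Lmodule.copy H (H1 * H2)%type.

Definition hprod_norm (z : H) : R := Num.sqrt (`|z.1| ^+ 2 + `|z.2| ^+ 2).

Lemma hprod_normD (x y : H) :
  hprod_norm (x + y) <= hprod_norm x + hprod_norm y.
Proof.
rewrite /hprod_norm /=.
set a := `|x.1|; set b := `|x.2|; set c := `|y.1|; set d := `|y.2|.
have [a0 b0 c0 d0] : [/\ 0 <= a, 0 <= b, 0 <= c & 0 <= d].
  by split; exact: normr_ge0.
have p0 : 0 <= a ^+ 2 + b ^+ 2 by rewrite addr_ge0 ?sqr_ge0.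
have q0 : 0 <= c ^+ 2 + d ^+ 2 by rewrite addr_ge0 ?sqr_ge0.
apply: (@le_trans _ _ (Num.sqrt ((a + c) ^+ 2 + (b + d) ^+ 2))).
  rewrite ler_sqrt ?addr_ge0 ?sqr_ge0//.
  by apply: lerD; rewrite ler_sqr ?nnegrE ?addr_ge0// ler_normD.
rewrite -[leRHS]ger0_norm ?addr_ge0 ?sqrtr_ge0// -sqrtr_sqr.
rewrite ler_sqrt ?sqr_ge0// [leRHS]sqrrD !sqr_sqrtr// -sqrtrM//.
have acbd : a * c + b * d <= Num.sqrt ((a ^+ 2 + b ^+ 2) * (c ^+ 2 + d ^+ 2)).
  rewrite -[leLHS]ger0_norm ?addr_ge0 ?mulr_ge0// -sqrtr_sqr.
  rewrite ler_sqrt ?mulr_ge0// -subr_ge0.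
  rewrite [X in 0 <= X](_ : _ = (a * d - b * c) ^+ 2) ?sqr_ge0//.
  by ring.
have -> : (a + c) ^+ 2 + (b + d) ^+ 2 =
    a ^+ 2 + b ^+ 2 + (a * c + b * d) *+ 2 + (c ^+ 2 + d ^+ 2) by ring.
by rewrite lerD2r lerD2l lerMn2r/=.
Qed.

Lemma hprod_normZ (l : R) (x : H) : hprod_norm (l *: x) = `|l| * hprod_norm x.
Proof.
rewrite /hprod_norm /= !normrZ !exprMn -mulrDr sqrtrM ?sqr_ge0//.
by rewrite sqrtr_sqr normr_id.
Qed.

Lemma hprod_norm0_eq0 (x : H) : hprod_norm x = 0 -> x = 0.
Proof.
move=> /eqP; rewrite /hprod_norm sqrtr_eq0 => x0.
have : `|x.1| ^+ 2 + `|x.2| ^+ 2 == 0 by rewrite eq_le x0 addr_ge0 ?sqr_ge0.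
rewrite paddr_eq0 ?sqr_ge0// !sqrf_eq0 !normr_eq0 => /andP[/eqP x1 /eqP x2].
by case: x x1 x2 {x0} => /= ? ? -> ->.
Qed.

HB.instance Definition _ := @Lmodule_isNormed.Build R H hprod_norm
  hprod_normD hprod_normZ hprod_norm0_eq0.

Lemma hprod_normE (z : H) : `|z| = Num.sqrt (`|z.1| ^+ 2 + `|z.2| ^+ 2).
Proof. by []. Qed.

Lemma hprod_norm1 (z : H) : `|z.1| <= `|z|.
Proof.
rewrite hprod_normE -[leLHS]ger0_norm// -sqrtr_sqr.
by rewrite ler_sqrt ?addr_ge0 ?sqr_ge0// lerDl sqr_ge0.
Qed.

Lemma hprod_norm2 (z : H) : `|z.2| <= `|z|.
Proof.
rewrite hprod_normE -[leLHS]ger0_norm// -sqrtr_sqr.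
by rewrite ler_sqrt ?addr_ge0 ?sqr_ge0// lerDr sqr_ge0.
Qed.

Lemma hprod_norm_le (z : H) : `|z| <= `|z.1| + `|z.2|.
Proof.
rewrite hprod_normE -[leRHS]ger0_norm ?addr_ge0// -sqrtr_sqr.
rewrite ler_sqrt ?sqr_ge0// sqrrD addrAC lerDl.
by rewrite mulrn_wge0// mulr_ge0.
Qed.

Lemma hprod_complete (F : set_system H) : ProperFilter F -> cauchy F -> cvg F.
Proof.
move=> FF /cauchy_ballP Fc.
have cauchy_proj (V : hilbertType R) (pr : H -> V) :
    (forall x y : H, `|pr x - pr y| <= `|x - y|) -> cvg (pr @ F).
  move=> prxy; apply: cauchy_cvg; apply/cauchy_ballP => e e0.
  rewrite near_map2; have := Fc e e0; apply: filterS => -[x y].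
  rewrite -!ball_normE /ball_ /=.
  exact: le_lt_trans.
have /cvg_ex[/= l1 Fl1] := cauchy_proj H1 fst (fun x y => hprod_norm1 (x - y)).
have /cvg_ex[/= l2 Fl2] := cauchy_proj H2 snd (fun x y => hprod_norm2 (x - y)).
apply/cvg_ex; exists ((l1, l2) : H).
apply/cvgrPdist_lt => e e0; have e20 : 0 < e / 2 by rewrite divr_gt0.
have F1 : \forall z \near F, `|l1 - z.1| < e / 2.
  by move/cvgrPdist_lt : Fl1; exact.
have F2 : \forall z \near F, `|l2 - z.2| < e / 2.
  by move/cvgrPdist_lt : Fl2; exact.
near=> z.
apply: le_lt_trans (hprod_norm_le _) _; rewrite [e]splitr ltrD//=.
- by near: z; exact: F1.
- by near: z; exact: F2.
Unshelve. all: by end_near. Qed.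

HB.instance Definition _ := Uniform_isComplete.Build H hprod_complete.

Definition hprod_dot (x y : H) : R := hdot x.1 y.1 + hdot x.2 y.2.

Lemma hprod_dot_bilinear :
  bilinear_for ( *%R : GRing.Scale.law R R)
    (idfun \; *%R : GRing.Scale.law R R) hprod_dot.
Proof.
split=> [y|x] a u v; rewrite /hprod_dot /=.
- by rewrite !linearPl/= mulrDr addrACA.
- by rewrite !linearPr/= mulrDr addrACA.
Qed.

HB.instance Definition _ := bilinear_isBilinear.Build R H H R
  *%R (idfun \; *%R) hprod_dot hprod_dot_bilinear.

Lemma hprod_dotC (x y : H) :
  hprod_dot x y = (-1) ^+ false * idfun (hprod_dot y x).
Proof.
by rewrite /hprod_dot (hermitian_subproof x.1) (hermitian_subproof x.2)/= !mul1r.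
Qed.

HB.instance Definition _ := isHermitianSesquilinear.Build R H false idfun
  hprod_dot hprod_dotC.

Lemma hprod_dot_norm (x : H) : hprod_dot x x = `|x| ^+ 2.
Proof.
by rewrite hprod_normE sqr_sqrtr ?addr_ge0 ?sqr_ge0// /hprod_dot !hdot_norm.
Qed.

Lemma hprod_dot_gt0 (x : H) : x != 0 -> 0 < hprod_dot x x.
Proof. by move=> x0; rewrite hprod_dot_norm exprn_gt0// normr_gt0. Qed.

HB.instance Definition _ := isDotProduct.Build R H hprod_dot hprod_dot_gt0.

HB.instance Definition _ := CompleteNormedModule_isHilbert.Build R H
  hprod_dot_norm.

End hprod_normed.

Section hilbert_notions.
Context {R : realType} {H : hilbertType R}.
Local Open Scope ereal_scope.

(* The supremum is taken in the extended reals: an unbounded set has diameter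
   [+oo] and the empty set [-oo]. *)
Definition diam (B : set H) : \bar R :=
  ereal_sup [set `|u - v|%:E | u in B & v in B].

Definition kuratowski (G : set H) : \bar R :=
  ereal_inf [set e%:E | e in [set e : R | (0 < e)%R /\
    exists n (P : 'I_n -> set H),
      G `<=` \bigcup_i P i /\ forall i, diam (P i) < e%:E]].

Definition upper_semicontinuous_on (K : set H) (h : H -> R) :=
  forall (x : H) (u : H^nat), K x -> (forall n, K (u n)) ->
    u @ \oo --> x -> limn_esup (fun n => (h (u n))%:E) <= (h x)%:E.

End hilbert_notions.

Definition bounded_operator (R : realType) (H1 H2 : hilbertType R)
    (A : H1 -> H2) :=
  exists M : R, forall x, `|A x| <= M * `|x|.

(* The bifunctions [f] and [g] are total functions of which only the values on
   [C * C] and [Q * Q] are ever used. *)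
Section split_equilibrium_problem.
Context {R : realType} {H1 H2 : hilbertType R}.
Variables (C : set H1) (Q : set H2) (A : H1 -> H2).
Variables (f : H1 -> H1 -> R) (g : H2 -> H2 -> R).

Definition SEP_sol : set (hprod H1 H2) :=
  [set z | [/\ C z.1, Q z.2, z.2 = A z.1,
    forall p, C p -> 0 <= f z.1 p & forall q, Q q -> 0 <= g z.2 q]].

Definition SEP_approx (e : R) : set (hprod H1 H2) :=
  [set z | [/\ C z.1, Q z.2, `|z.2 - A z.1| <= e,
    forall p, C p -> - e <= f z.1 p & forall q, Q q -> - e <= g z.2 q]].

Definition SEP_approximating_seq (u : (hprod H1 H2)^nat) :=
  exists e : R^nat, [/\ forall n, 0 < e n, e @ \oo --> (0 : R)
    & forall n, SEP_approx (e n) (u n)].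

Definition SEP_generalized_well_posed :=
  SEP_sol !=set0 /\
  forall u, SEP_approximating_seq u ->
    exists2 s : nat -> nat, increasing_seq s &
    exists2 z, SEP_sol z & u \o s @ \oo --> z.

End split_equilibrium_problem.

(* Main.v *)
Require Import Defs.
From mathcomp Require Import all_boot all_order all_algebra.
From mathcomp Require Import lra.
From mathcomp Require Import all_classical all_reals all_analysis.

Set Implicit Arguments.
Unset Strict Implicit.
Unset Printing Implicit Defensive.

Import Order.TTheory GRing.Theory Num.Theory.
Import numFieldNormedType.Exports.

Local Open Scope classical_set_scope.
Local Open Scope ring_scope.

(** Only two features of the family e |-> S(e) matter for the measure of
noncompactness: it grows with e, and H1 x H2 is complete. For any such family
K(e), alpha(K(e)) --> 0 as e --> 0 holds exactly when every sequence u with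
u n in K(e n) and e n --> 0 has a convergent subsequence.

- If alpha(K(e)) does not tend to 0 then, by monotonicity, it is always at least
  some d > 0, so that no K(e) is covered by finitely many balls of radius d / 6.
  Choosing points u n in K(1 / (n + 1)) one after the other outside the balls
  around the previous ones gives a d / 6-separated sequence, and such a
  sequence has no convergent subsequence
  ([kuratowski_cvg0_of_cvg_subseq]).

- If alpha(K(e)) --> 0, then for every d > 0 a tail of u lies in a finite union
  of sets of diameter less than d. An ultrafilter that contains the tails of u
  must contain one of these sets. It is therefore Cauchy, hence convergent, and
  its limit is a cluster point of u, to which a subsequence converges
  ([cvg_subseq_of_kuratowski_cvg0]).

What is specific to the equilibrium problem is that a limit of an
approximating sequence is an exact solution ([SEP_approx_cvg_sol]): C and Q are
closed, A is continuous, and upper semicontinuity carries the bounds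
- e n <= f (x_n) p over to the limit. Well-posedness gives S(e) nonempty since
S is contained in S(e); conversely, picking a point in each S(1 / (n + 1)) and
passing to the limit gives a point of S. *)

(** * The measure of noncompactness *)

Section kuratowski_measure.
Context {R : realType} {H : hilbertType R}.
Implicit Types (B G : set H).

Lemma diam_lt_dist B (e : R) (x y : H) :
  (diam B < e%:E)%E -> B x -> B y -> `|x - y| < e.
Proof.
move=> Be Bx By; rewrite -lte_fin; apply: le_lt_trans Be.
by apply: ereal_sup_ubound; exists x => //; exists y.
Qed.

Lemma diam_ball_lt (x : H) (r : R) : 0 < r -> (diam (ball x r) < (3 * r)%:E)%E.
Proof.
move=> r0; apply: (@le_lt_trans _ _ (2 * r)%:E); last first.
  by rewrite lte_fin ltr_pM2r// ltr_nat.
apply: ge_ereal_sup => _ [u xu [v xv <-]]; rewrite lee_fin.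
rewrite mulr_natl mulr2n (le_trans (ler_distD x _ _))// lerD//; apply: ltW.
- by move: xu; rewrite -ball_normE/= distrC.
- by move: xv; rewrite -ball_normE.
Qed.

Lemma kuratowski_ge0 G : (0 <= kuratowski G)%E.
Proof. by apply: le_ereal_inf_tmp => _ [e [e0 _] <-]; rewrite lee_fin ltW. Qed.

Lemma kuratowski_subset B G : B `<=` G -> (kuratowski B <= kuratowski G)%E.
Proof.
move=> BG; apply: ereal_inf_le_tmp => _ [e [e0 [n [P [GP dP]]]] <-].
exists e => //; split => //; exists n, P; split => //; exact: subset_trans GP.
Qed.

Lemma kuratowski_lt_cover G (e : R) : (kuratowski G < e%:E)%E ->
  exists n (P : 'I_n -> set H),
    G `<=` \bigcup_i P i /\ forall i, (diam (P i) < e%:E)%E.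
Proof.
move=> /ereal_inf_lt[_ [d [d0 [n [P [GP dP]]]] <-] de].
by exists n, P; split => // i; exact: lt_trans (dP i) de.
Qed.

(** The constant 3 rather than 2 leaves room for the strict inequality on
diameters in the definition of the measure. *)
Lemma kuratowski_le_ball_cover G (r : R) (s : seq H) : 0 < r ->
  (forall x, G x -> exists2 y, y \in s & `|x - y| < r) ->
  (kuratowski G <= (3 * r)%:E)%E.
Proof.
move=> r0 Gs; apply: ereal_inf_lbound; exists (3 * r) => //.
split; first by rewrite mulr_gt0.
exists (size s), (fun i => ball (tnth (in_tuple s) i) r); split; last first.
  by move=> i; exact: diam_ball_lt.
move=> x /Gs[y ys xy].
have ys' : (index y s < size s)%N by rewrite index_mem.
exists (Ordinal ys') => //.
by rewrite -ball_normE /= (tnth_nth y)/= nth_index// distrC.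
Qed.

End kuratowski_measure.

(** * Sequences and subsequences *)

(** If finitely many balls of radius r never cover any G n, points can be chosen
one by one away from all the previous ones. *)
Lemma separated_sequence (R : realType) (V : normedModType R)
    (G : nat -> set V) (r : R) :
  (forall n (s : seq V),
    exists x, G n x /\ forall y, y \in s -> r <= `|x - y|) ->
  exists2 u : V^nat, forall n, G n (u n) &
    forall m n, (m < n)%N -> r <= `|u n - u m|.
Proof.
move=> Gr; pose next n s := projT1 (cid (Gr n s)).
have nextP n s : G n (next n s) /\ forall y, y \in s -> r <= `|next n s - y|.
  by rewrite /next; case: cid.
(* [l n] lists the points chosen before step [n], latest first. *)
pose l := fix l n := if n is m.+1 then next m (l m) :: l m else [::].
exists (fun n => next n (l n)) => [n|m n mn]; first by have [] := nextP n (l n).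
apply: (nextP n (l n)).2.
elim: n mn => // n IH; rewrite ltnS leq_eqVlt => /predU1P[->|/IH mn] /=.
  by rewrite mem_head.
by rewrite in_cons mn orbT.
Qed.

Lemma separated_no_cvg_subseq (R : realType) (V : normedModType R)
    (u : V^nat) (r : R) (s : nat -> nat) (z : V) : 0 < r ->
  (forall m n, (m < n)%N -> r <= `|u n - u m|) ->
  increasing_seq s -> ~ (u \o s @ \oo --> z).
Proof.
move=> r0 ur /increasing_seqP incs /cvgrPdist_lt/(_ (r / 2)).
rewrite divr_gt0// => /(_ isT)[N _ uN].
have := ur _ _ (incs N); rewrite leNgt => /negP; apply.
rewrite (le_lt_trans (ler_distD z _ _))// [r]splitr ltrD//.
  by rewrite distrC; exact: uN (leqnSn N).
exact: uN (leqnn N).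
Qed.

Lemma increasing_seq_cvg_infty (s : nat -> nat) :
  increasing_seq s -> s @ \oo --> \oo.
Proof.
move=> /increasing_seqP incs.
have les n : (n <= s n)%N by elim: n => // n /leq_ltn_trans; apply; exact: incs.
by move=> B [N _ NB]; exists N => // n Nn; apply: NB; exact: leq_trans (les n).
Qed.

(** This reduces to the case of real sequences: if z is a cluster point of u,
then 0 is a cluster point of the distances |z - u n|, and indices along which
these distances tend to 0 are indices along which u tends to z. *)
Lemma cluster_cvg_subseq (R : realType) (V : normedModType R) (u : V^nat)
    (z : V) : cluster (u @ \oo) z ->
  exists2 s : nat -> nat, increasing_seq s & u \o s @ \oo --> z.
Proof.
move=> uz.
have : cluster ((fun n => `|z - u n|) @ \oo) (0 : R).
  move=> A B uA /nbhs_ballP[e/= e0 eB].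
  have uW : (u @ \oo) (u @` [set n | A `|z - u n|]).
    by move: uA; apply: (@filterS _ \oo) => n An; exists n.
  have [_ [[n An <-] zn]] := uz _ _ uW (nbhsx_ballx z e e0).
  exists `|z - u n|; split => //; apply: eB.
  by move: zn; rewrite -!ball_normE /ball_/= sub0r normrN normr_id.
move=> /cluster_eventually_cvg[s incs us]; exists s => //.
apply/cvgrPdist_lt => e e0; move/cvgrPdist_lt : us => /(_ e e0).
by apply: filterS => n; rewrite sub0r normrN normr_id.
Qed.

(** Otherwise the ultrafilter would contain every complement of a P i, hence a
set disjoint from their union. *)
Lemma ultra_bigcup (T : Type) (F : set_system T) n (P : 'I_n -> set T) :
  UltraFilter F -> F (\bigcup_i P i) -> exists i, F (P i).
Proof.
move=> FU FP; apply/not_existsP => nFP.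
have : F [set x | forall i, ~ P i x].
  apply: filter_forall => i.
  by have [/nFP|] := in_ultra_setVsetC (P i) FU.
move=> /(filterI FP)/filter_ex[x [[i _ Pix] /(_ i)]]; exact.
Qed.

Lemma cvg_le_limn_esup (R : realType) (v w : (\bar R)^nat) (l : \bar R) :
  (forall n, w n <= v n)%E -> w @ \oo --> l -> (l <= limn_esup v)%E.
Proof.
move=> wv wl.
have := is_cvg_limn_esupE (cvgP _ wl); rewrite (cvg_lim _ wl)// => <-.
rewrite !limn_esup_lim.
apply: lee_lim; [exact/is_cvg_esups|exact/is_cvg_esups|].
apply: nearW => n; apply: ge_ereal_sup => _ [m mn <-].
by apply: (le_trans (wv m)); apply: ereal_sup_ubound; exists m.
Qed.

(** * Measures tending to zero and convergent subsequences *)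

Section approximating_family.
Context {R : realType} {H : hilbertType R}.
Variable K : R -> set H.
Hypothesis K_homo : forall d e, d <= e -> K d `<=` K e.

(** Monotonicity turns convergence at 0+ into the existence of a single good
parameter for each bound, which is the form in which both directions of the
theorem use it. *)
Lemma kuratowski_cvg0P :
  kuratowski (K e) @[e --> 0^'+] --> 0%E <->
  forall d : R, 0 < d -> exists2 e, 0 < e & (kuratowski (K e) < d%:E)%E.
Proof.
split=> [/fine_cvgP[Kfin /cvgrPdist_lt Kd] d d0|Kd].
  have {}Kd := Kd d d0.
  near (0 : R)^'+ => e; exists e => //.
  have Ke : kuratowski (K e) \is a fin_num by near: e.
  rewrite -(fineK Ke) lte_fin (le_lt_trans (ler_norm _))//.
  by rewrite -normrN -sub0r; near: e.
have Klt d : 0 < d -> \forall e \near 0^'+, (kuratowski (K e) < d%:E)%E.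
  move=> /Kd[e e0 Ke]; near=> t.
  apply: le_lt_trans Ke; apply/kuratowski_subset/K_homo.
  by near: t; exact: nbhs_right_le.
apply/fine_cvgP; split.
  apply: filterS (Klt 1 ltr01) => e Ke.
  by rewrite ge0_fin_numE ?kuratowski_ge0// (lt_trans Ke)// ltry.
apply/cvgrPdist_lt => d /Klt; apply: filterS => e Ke.
rewrite sub0r normrN ger0_norm ?fine_ge0 ?kuratowski_ge0//.
by rewrite -lte_fin fineK// ge0_fin_numE ?kuratowski_ge0// (lt_trans Ke)// ltry.
Unshelve. all: by end_near. Qed.

(** If one d > 0 bounded every measure from below, no K(e) would be covered by
finitely many balls of radius d / 6 (such a cover gives at most d / 2), and a
separated sequence would contradict the hypothesis. *)
Lemma kuratowski_cvg0_of_cvg_subseq :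
  (forall (e : R^nat) (u : H^nat), (forall n, 0 < e n) -> e @ \oo --> 0 ->
    (forall n, K (e n) (u n)) ->
    exists2 s : nat -> nat, increasing_seq s &
      exists z : H, u \o s @ \oo --> z) ->
  kuratowski (K e) @[e --> 0^'+] --> 0%E.
Proof.
move=> Ksub; apply/kuratowski_cvg0P => d d0; apply: contrapT => Kd.
have r0 : 0 < d / 6 by rewrite divr_gt0.
have [n s|u Ku ur] :=
    @separated_sequence R H (fun n => K (harmonic n)) (d / 6).
  apply: contrapT => nK; apply: Kd; exists (harmonic n).
    exact: harmonic_gt0.
  apply: (@le_lt_trans _ _ (3 * (d / 6))%:E); last by rewrite lte_fin; lra.
  apply: (@kuratowski_le_ball_cover _ _ _ _ s) => // x Kx.
  apply: contrapT => nx; apply: nK; exists x; split => // y ys.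
  by rewrite leNgt; apply/negP => xy; apply: nx; exists y.
have [s incs [z]] := Ksub harmonic u (fun=> harmonic_gt0 _) cvg_harmonic Ku.
exact: separated_no_cvg_subseq ur incs.
Qed.

(** An ultrafilter refining the tails of u replaces the diagonal extraction: it
selects one piece in each of the finite covers, so it is Cauchy. *)
Lemma cvg_subseq_of_kuratowski_cvg0 (e : R^nat) (u : H^nat) :
  kuratowski (K e) @[e --> 0^'+] --> 0%E ->
  e @ \oo --> 0 -> (forall n, K (e n) (u n)) ->
  exists2 s : nat -> nat, increasing_seq s & exists z : H, u \o s @ \oo --> z.
Proof.
move=> /kuratowski_cvg0P Kd e0 Ku.
have [F [FU uF]] : exists F, UltraFilter F /\ u @ \oo `<=` F.
  exact: ultraFilterLemma.
have Fcauchy : cauchy F.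
  apply/cauchy_ballP => d /Kd[t t0 /kuratowski_lt_cover[n [P [KP dP]]]].
  have /ultra_bigcup[i FPi] : F (\bigcup_i P i).
    apply: uF; move/cvgr_lt : e0 => /(_ _ t0); apply: filterS => m /ltW et.
    exact/KP/(K_homo et).
  exists (P i, P i) => // -[x y] [/= Px Py].
  by rewrite -ball_normE /=; exact: diam_lt_dist (dP i) Px Py.
have /cvg_ex[/= z Fz] : cvg F by exact: cauchy_cvg.
have [|s incs us] := @cluster_cvg_subseq _ _ u z; last first.
  by exists s => //; exists z.
by rewrite cluster_cvgE; exists F; [exact: ultra_proper|split].
Qed.

End approximating_family.

(** * Passing to the limit in approximate solutions *)

Lemma usc_lower_bound_cvg (R : realType) (H : hilbertType R) (K : set H)
    (h : H -> R) (u : H^nat) (e : R^nat) (x : H) :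
  upper_semicontinuous_on K h -> K x -> (forall n, K (u n)) ->
  u @ \oo --> x -> e @ \oo --> 0 -> (forall n, - e n <= h (u n)) -> 0 <= h x.
Proof.
move=> husc Kx Ku ux e0 eh; rewrite -lee_fin.
apply: le_trans (husc x u Kx Ku ux).
apply: (@cvg_le_limn_esup _ _ (fun n => (- e n)%:E)) => [n|].
  by rewrite lee_fin.
apply: cvg_EFin; first exact: nearW.
by rewrite -oppr0; exact: cvgN.
Qed.

Lemma bounded_operator_continuous (R : realType) (H1 H2 : hilbertType R)
  (A : {linear H1 -> H2}) : bounded_operator A -> continuous A.
Proof.
move=> [M AM]; apply: bounded_linear_continuous; apply/linear_boundedP.
near=> r => x; rewrite (le_trans (AM x))// ler_wpM2r//.
Unshelve. all: by end_near. Qed.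

Section hprod_cvg.
Context {R : realType} {H1 H2 : hilbertType R}.
Variables (u : (hprod H1 H2)^nat) (z : hprod H1 H2).
Hypothesis uz : u @ \oo --> z.

Lemma hprod_cvg_fst : (fun n => (u n).1) @ \oo --> z.1.
Proof.
apply/cvgrPdist_lt => e e0; move/cvgrPdist_lt : uz => /(_ e e0).
by apply: filterS => n; apply: le_lt_trans; exact: (hprod_norm1 (z - u n)).
Qed.

Lemma hprod_cvg_snd : (fun n => (u n).2) @ \oo --> z.2.
Proof.
apply/cvgrPdist_lt => e e0; move/cvgrPdist_lt : uz => /(_ e e0).
by apply: filterS => n; apply: le_lt_trans; exact: (hprod_norm2 (z - u n)).
Qed.

End hprod_cvg.

Section approximate_solutions.
Context {R : realType} {H1 H2 : hilbertType R}.
Variables (C : set H1) (Q : set H2) (A : {linear H1 -> H2}).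
Variables (f : H1 -> H1 -> R) (g : H2 -> H2 -> R).

Lemma SEP_sol_approx (e : R) :
  0 <= e -> SEP_sol C Q A f g `<=` SEP_approx C Q A f g e.
Proof.
move=> e0 z [Cz Qz zA fz gz]; split => //.
- by rewrite zA subrr normr0.
- by move=> p /fz; apply: le_trans; rewrite oppr_le0.
- by move=> q /gz; apply: le_trans; rewrite oppr_le0.
Qed.

Lemma SEP_approx_homo (d e : R) :
  d <= e -> SEP_approx C Q A f g d `<=` SEP_approx C Q A f g e.
Proof.
move=> de z [Cz Qz zA fz gz]; split => //; first exact: le_trans de.
- by move=> p /fz; apply: le_trans; rewrite lerN2.
- by move=> q /gz; apply: le_trans; rewrite lerN2.
Qed.

(** All five conditions defining S(e) survive in the limit, with e replaced
by 0. *)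
Lemma SEP_approx_cvg_sol (e : R^nat) (u : (hprod H1 H2)^nat)
    (z : hprod H1 H2) :
  closed C -> closed Q -> bounded_operator A ->
  (forall p, C p -> upper_semicontinuous_on C (fun x => f x p)) ->
  (forall q, Q q -> upper_semicontinuous_on Q (fun y => g y q)) ->
  e @ \oo --> 0 -> (forall n, SEP_approx C Q A f g (e n) (u n)) ->
  u @ \oo --> z -> SEP_sol C Q A f g z.
Proof.
move=> clC clQ /bounded_operator_continuous cA fusc gusc e0 Su uz.
have u1 := hprod_cvg_fst uz; have u2 := hprod_cvg_snd uz.
have Cu n : C (u n).1 by have [] := Su n.
have Qu n : Q (u n).2 by have [] := Su n.
have Cz : C z.1 by apply: closed_cvg clC _ _ u1; exact: nearW.
have Qz : Q z.2 by apply: closed_cvg clQ _ _ u2; exact: nearW.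
split => //.
- apply/subr0_eq/eqP; rewrite -normr_le0.
  have Au1 : (fun n => A (u n).1) @ \oo --> A z.1.
    by apply: continuous_cvg => //; exact: cA.
  have Aw : (fun n => `|(u n).2 - A (u n).1|) @ \oo --> `|z.2 - A z.1|.
    by apply: cvg_norm; apply: cvgB.
  rewrite -(cvg_lim _ Aw)// -(cvg_lim _ e0)//.
  apply: ler_lim; [exact: cvgP Aw|exact: cvgP e0|].
  by apply: nearW => n; have [] := Su n.
- move=> p Cp; apply: (usc_lower_bound_cvg (fusc p Cp) Cz Cu u1 e0) => n.
  by have [_ _ _ + _] := Su n; exact.
- move=> q Qq; apply: (usc_lower_bound_cvg (gusc q Qq) Qz Qu u2 e0) => n.
  by have [_ _ _ _] := Su n; exact.
Qed.

End approximate_solutions.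

Theorem theorem3p10 (R : realType) (H1 H2 : hilbertType R)
    (C : set H1) (Q : set H2) (A : {linear H1 -> H2})
    (f : H1 -> H1 -> R) (g : H2 -> H2 -> R)
    (C_neq0 : C !=set0) (C_closed : closed C)
    (C_convex : convex_set (C : set (convex_lmodType H1)))
    (Q_neq0 : Q !=set0) (Q_closed : closed Q)
    (Q_convex : convex_set (Q : set (convex_lmodType H2)))
    (A_bounded : bounded_operator A)
    (f_usc : forall p, C p -> upper_semicontinuous_on C (fun x => f x p))
    (g_usc : forall q, Q q -> upper_semicontinuous_on Q (fun y => g y q)) :
  SEP_generalized_well_posed C Q A f g <->
  (forall e : R, 0 < e -> SEP_approx C Q A f g e !=set0) /\
  kuratowski (SEP_approx C Q A f g e) @[e --> 0^'+] --> 0%E.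
Proof.
have hom := @SEP_approx_homo _ _ _ C Q A f g.
split=> [[[z Sz] Ssub]|[Sn0 Sk]].
  split=> [e e0|]; first by exists z; exact: SEP_sol_approx (ltW e0) _ Sz.
  apply: (kuratowski_cvg0_of_cvg_subseq hom) => e u epos e0 Su.
  have [|s incs [w _ uw]] := Ssub u; first by exists e.
  by exists s => //; exists w.
have Ssub u : SEP_approximating_seq C Q A f g u ->
    exists2 s : nat -> nat, increasing_seq s &
    exists2 z, SEP_sol C Q A f g z & u \o s @ \oo --> z.
  move=> [e [_ e0 Su]].
  have [s incs [z uz]] := cvg_subseq_of_kuratowski_cvg0 hom Sk e0 Su.
  exists s => //; exists z => //.
  apply: (@SEP_approx_cvg_sol _ _ _ _ _ _ _ _ (e \o s) (u \o s)) => //=.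
  exact: cvg_comp (increasing_seq_cvg_infty incs) e0.
split => //.
(* Any selection from the sets S(1 / (n + 1)) is an approximating sequence, so
   that a solution arises as the limit of a subsequence. *)
pose u n := projT1 (cid (Sn0 (harmonic n) (harmonic_gt0 n))).
have [|s _ [z Sz _]] := Ssub u; last by exists z.
exists harmonic; split; [exact: harmonic_gt0|exact: cvg_harmonic|].
by move=> n; rewrite /u; case: cid.
Qed.
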